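(* Let $1=G_0\le G_1\le\cdots$ be an $r$-differential tower of groups with associated $r$-differential poset $P$, let $n\ge0$ and $k\in\mathbb{Z}$, and let $A:=DU_n+kI\in\mathbb{Z}^{p_n\times p_n}$. Then the last diagonal entry $s_{p_n}$ of the Smith normal form of $A$ over $\mathbb{Z}$ is $0$ when $A$ is singular, and when $A$ is nonsingular it equals (up to sign) $$s_{p_n}=\begin{cases}(n+1)!_{r,k}&\text{if } r\ge2,\\ (n-1)!_{1,k}\cdot(n+1+k)&\text{if } r=1.\end{cases}$$
   Context: An $r$-differential tower of groups is a chain of finite groups $1=G_0\le G_1\le\cdots$ such that restriction of irreducible characters from $G_n$ to $G_{n-1}$ is multiplicity-free and $\mathrm{Res}^{G_{n+1}}_{G_n}\mathrm{Ind}^{G_{n+1}}_{G_n}-\mathrm{Ind}^{G_n}_{G_{n-1}}\mathrm{Res}^{G_n}_{G_{n-1}}=r\cdot\mathrm{id}$ on the $\mathbb{Z}$-module of virtual characters of $G_n$ for all $n$ (second term $0$ for $n=0$). The associated poset $P$ has rank-$n$ set $P_n=\mathrm{Irr}(G_n)$ (so $p_n=|\mathrm{Irr}(G_n)|$), and $\psi\in\mathrm{Irr}(G_n)$ covers $\chi\in\mathrm{Irr}(G_{n-1})$ iff $\chi$ is a constituent of $\mathrm{Res}^{G_n}_{G_{n-1}}\psi$; it is an $r$-differential poset. Its up map $U_n:\mathbb{Z}^{P_n}\to\mathbb{Z}^{P_{n+1}}$ sends each element to the sum of the elements covering it, the down map $D_{n+1}=U_n^t$, and $DU_n=D_{n+1}U_n$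 (this is the matrix of $\mathrm{Res}^{G_{n+1}}_{G_n}\mathrm{Ind}^{G_{n+1}}_{G_n}$ in the basis $\mathrm{Irr}(G_n)$). For integers $\ell$, $\ell!_{r,k}:=(r\ell+k)(r(\ell-1)+k)\cdots(r\cdot1+k)$, an empty product (equal to $1$) when $\ell\le0$. *)

(* Defs.v *)
From HB Require Import structures.
From mathcomp Require Import all_boot all_order all_algebra all_fingroup all_solvable all_field all_character.
Set Implicit Arguments. Unset Strict Implicit. Unset Printing Implicit Defensive.
Import Order.TTheory GRing.Theory Num.Theory.
Local Open Scope ring_scope.

(* A tower 1 = G_0 <= G_1 <= ... of finite groups.  Since an infinite
   strictly increasing chain cannot live inside a single finite group type,
   each G_m lives in its own finGroupType, and the inclusion G_m <= G_(m+1)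
   is an injective group morphism tw_f m : G_m -> G_(m+1)
   (identifying G_m with its image). *)
Record group_tower := GroupTower {
  tw_gT : nat -> finGroupType;
  tw_G : forall m, {group tw_gT m};
  tw_f : forall m, {morphism tw_G m >-> tw_gT m.+1};
  tw_inj : forall m, ('injm (tw_f m))%g;
  tw_sub : forall m, (tw_f m @* tw_G m \subset tw_G m.+1)%g;
  tw_G0 : #|tw_G 0| = 1%N
}.

Section Tower.
Variable T : group_tower.
Local Notation G := (tw_G T).
Local Notation f := (tw_f T).

Definition tw_img m : {group tw_gT T m.+1} := (f m @* G m)%G.

Definition tw_isom m : isom (G m) (tw_img m) (f m) :=
  introT isomP (conj (tw_inj T m) (erefl _)).

Definition twRes m (psi : 'CF(G m.+1)) : 'CF(G m) :=
  cfMorph ('Res[tw_img m] psi).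

Definition twInd m (chi : 'CF(G m)) : 'CF(G m.+1) :=
  'Ind[G m.+1] (cfIsom (tw_isom m) chi).

Definition twIndRes m : 'CF(G m) -> 'CF(G m) :=
  match m return 'CF(G m) -> 'CF(G m) with
  | 0 => fun _ => 0
  | m'.+1 => fun phi => twInd (twRes phi)
  end.

Definition r_differential_tower (r : nat) : Prop :=
  (forall m (i : Iirr (G m.+1)) (j : Iirr (G m)),
      '[twRes 'chi_i, 'chi_j] = 0 \/ '[twRes 'chi_i, 'chi_j] = 1)
  /\
  (forall m (phi : 'CF(G m)), phi \in ('Z[irr (G m)])%g ->
      twRes (twInd phi) - twIndRes phi = r%:R *: phi).

(* The up map U_m of the associated poset, as a p_(m+1) x p_m integer
   matrix (acting on column vectors): entry (i, j) is 1 iff chi_i of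
   G_(m+1) covers chi_j of G_m, i.e. chi_j is a constituent of
   Res chi_i. *)
Definition upmx m : 'M[int]_(Nirr (G m.+1), Nirr (G m)) :=
  \matrix_(i, j) ((j \in irr_constt (twRes 'chi_i)) : nat)%:Z.

(* DU_m = D_(m+1) U_m with D_(m+1) = U_m^T *)
Definition DUmx m : 'M[int]_(Nirr (G m)) := (upmx m)^T *m upmx m.

End Tower.

Definition smith_diag n (M : 'M[int]_n) (d : seq int) : Prop :=
  size d = n /\ sorted (fun a b : int => (a %| b)%Z) d /\
  exists L R : 'M[int]_n, [/\ L \in unitmx, R \in unitmx &
    M = L *m diag_mx (\row_(i < n) d`_i) *m R].

Definition fact_rk (r k l : int) : int :=
  if l <= 0 then 1 else \prod_(1 <= i < (absz l).+1) (r * i%:Z + k).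

(* Main.v *)
Require Import Defs.
From mathcomp Require Import all_boot all_order all_algebra all_fingroup all_solvable all_field all_character.
From mathcomp Require Import zify ring.
Import Order.TTheory GRing.Theory Num.Theory.
Local Open Scope ring_scope.

(** Let [E = U D] on rank [n], so that [A = E + r + k].  The commutation rule
    gives [U^j D^j = E (E - r) ... (E - (j - 1) r)], which vanishes for
    [j = n + 1].  Newton interpolation of [1 / (x + r + k)] at the nodes
    [0, r, ..., n r] then yields an integer matrix [Q], a combination of the
    [U^j D^j] in which [U^n D^n] has coefficient [(-1)^n], such that
    [Q A = (n+1)!_{r,k} I].  When [r = 1] there is a single element of rank 1, so
    [U^n D^n = U^(n-1) D^(n-1)], the node [n - 1] drops out, and the scalar becomes
    [(n-1)!_{1,k} (n + 1 + k)].

    If [Q A = s I] and [Q] has an entry [1] or [-1], then the last invariant factor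
    of [A] is [s] up to sign.  Such an entry sits at a pair of elements of rank
    [n] that are the tops of two chains of elements each covering only its
    predecessor, and that separate right after rank 0 (rank 1 if [r = 1]): only
    one [U^j D^j] is nonzero there among those occurring in [Q].  A counting
    argument shows that such chains can always be prolonged. *)

(** * The last diagonal entry of a Smith form *)

Lemma sorted_dvdz_last (n : nat) (d : seq int) (l : 'I_n.+1) :
  size d = n.+1 -> sorted (fun a b : int => (a %| b)%Z) d -> (d`_l %| d`_n)%Z.
Proof.
move=> sz_d; have tr : transitive (fun a b : int => (a %| b)%Z).
  by move=> b a c; apply: dvdz_trans.
move/(sorted_leq_nth tr dvdzz 0); apply; rewrite ?inE ?sz_d ?ltn_ord //.
by rewrite -ltnS ltn_ord.
Qed.

(** With [t] the last diagonal entry, [A *m B = t I] for an integer matrix [B], so [s B = t Q] and a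
    unit entry of [Q] gives [s | t]. The corner entry of [R Q L D = s I] gives [t | s]. *)
Lemma smith_diag_last (n : nat) (A Q : 'M[int]_n) (d : seq int) (s : int)
    (i j : 'I_n) :
  smith_diag A d -> Q *m A = s%:M -> `|Q i j| = 1 -> `|d`_n.-1| = `|s|.
Proof.
case: n A Q i j => [|n] A Q i j; first by case: i.
move=> [sz_d [sorted_d [L [R [uL uR defA]]]]] QA Qij.
have dvd_last (l : 'I_n.+1) : (d`_l %| d`_n)%Z by apply: sorted_dvdz_last.
set D := diag_mx _ in defA.
pose B := invmx R *m diag_mx (\row_(l < n.+1) (d`_n %/ d`_l)%Z) *m invmx L.
have AB : A *m B = (d`_n)%:M.
  rewrite defA /B !mulmxA mulmxK // -(mulmxA L D).
  have -> : D *m diag_mx (\row_(l < n.+1) (d`_n %/ d`_l)%Z) = (d`_n)%:M.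
    apply/matrixP=> a b; rewrite mul_diag_mx !mxE mulrnAr mulrC.
    by rewrite divzK.
  by rewrite mul_mx_scalar -scalemxAl mulmxV // scalemx1.
move: B AB => B AB.
have dvd1 : (s %| d`_n)%Z.
  have /matrixP/(_ i j) : (Q *m A) *m B = Q *m (A *m B) by rewrite mulmxA.
  rewrite QA AB mul_scalar_mx mul_mx_scalar !mxE => e.
  apply/dvdzP; exists (B i j * Q i j).
  rewrite mulrAC [_ * s]mulrC e -mulrA.
  by have [->|->] : Q i j = 1 \/ Q i j = -1; [lia | rewrite !mulr1 | rewrite mulrNN !mulr1].
have dvd2 : (d`_n %| s)%Z.
  have e : R *m Q *m L *m D = s%:M.
    have /(congr1 (fun M => R *m M *m invmx R)) := QA.
    rewrite defA !mulmxA mulmxK // => ->.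
    by rewrite mul_mx_scalar -scalemxAl mulmxV // scalemx1.
  move/matrixP/(_ ord_max ord_max): e.
  rewrite mul_mx_diag !mxE eqxx mulr1n /= => <-.
  by apply/dvdzP; eexists.
move: dvd1 dvd2; rewrite !dvdzE => dvd1 dvd2.
by rewrite -!abszE; congr Posz; apply/eqP; rewrite eqn_dvd dvd1 dvd2.
Qed.

Lemma smith_diag_singular (n : nat) (A : 'M[int]_n) (d : seq int) :
  smith_diag A d -> \det A = 0 -> d`_n.-1 = 0.
Proof.
case: n A => [|n] A; first by rewrite det_mx00.
move=> [sz_d [sorted_d [L [R [uL uR ->]]]]].
rewrite !det_mulmx det_diag => /eqP; rewrite !mulf_eq0.
have det_neq0 (M : 'M[int]_n.+1) : M \in unitmx -> (\det M == 0) = false.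
  by rewrite unitmxE => uM; apply/negbTE; apply: contraTneq uM => ->; rewrite unitr0.
rewrite !det_neq0 // orbF /= => /prodf_eq0[l _]; rewrite mxE => /eqP dl0.
apply/eqP; rewrite -dvd0z -[X in (X %| _)%Z]dl0.
exact: sorted_dvdz_last.
Qed.

Lemma ord_eq_size1 (n : nat) (x y : 'I_n) : n = 1%N -> x = y.
Proof. by move=> n1; move: x y; rewrite n1 => x y; rewrite (ord1 x) (ord1 y). Qed.

Lemma fact_rkE (r k : int) (n : nat) :
  fact_rk r k n%:Z = \prod_(i < n) (r * i.+1%:Z + k).
Proof.
rewrite /fact_rk; case: n => [|n]; first by rewrite big_ord0.
by rewrite big_add1 /= big_mkord.
Qed.

(** * Matrices obeying the commutation rule *)

Section DifferentialMatrices.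

Variables (p : nat -> nat) (U : forall m, 'M[int]_(p m.+1, p m)) (r : nat).

Definition UDmx (m : nat) : 'M[int]_(p m) :=
  match m return 'M[int]_(p m) with
  | 0 => 0
  | m'.+1 => U m' *m (U m')^T
  end.

Hypothesis p0 : p 0 = 1%N.
Hypothesis U01 : forall m i j, U m i j = 0 \/ U m i j = 1.
Hypothesis U_row_neq0 : forall m i, exists j, U m i j != 0.
Hypothesis U_comm : forall m, (U m)^T *m U m = UDmx m + (r%:Z)%:M.

(* The falling factorial [E (E - r) ... (E - (j - 1) r)] of [E = UDmx n]; it is
   the operator [U^j D^j] of rank [n]. *)
Fixpoint UDfall (n j : nat) : 'M[int]_(p n) :=
  if j is j'.+1 then UDfall n j' *m (UDmx n - ((r * j')%:Z)%:M) else 1%:M.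

(** By the commutation rule, moving [UDmx n.+1 - r (j + 1)] leftwards past [(U n)^T] turns it into
    [UDmx n - r j]. *)
Lemma UDfallS n j : UDfall n.+1 j.+1 = U n *m UDfall n j *m (U n)^T.
Proof.
elim: j => [|j IHj].
  by rewrite /= muln0 mul1mx mulmx1 raddf0 subr0.
rewrite [LHS]/= -/(UDfall n.+1 j.+1) IHj [UDfall n j.+1]/= -!mulmxA.
congr (_ *m (_ *m _)).
rewrite mulmxBr mulmxBl mulmxA U_comm mulmxDl.
rewrite mul_mx_scalar !mul_scalar_mx -addrA -scalerBl -scaleNr.
by congr (_ + _ *: _); lia.
Qed.

Lemma UDfall_rank n : UDfall n n.+1 = 0.
Proof.
elim: n => [|n IHn]; last by rewrite UDfallS IHn mulmx0 mul0mx.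
by rewrite /= muln0 mul1mx raddf0 subr0.
Qed.

Section Newton.

Variables (n : nat) (k : int).

Let a (j : nat) : int := r%:Z * j.+1%:Z + k.

Definition newton_mx (j : nat) : 'M[int]_(p n) :=
  iteri j (fun i Q => a i *: Q + (-1) ^+ i *: UDfall n i) 0.

(* Newton interpolation of [1 / (x + r + k)] at the nodes [0, r, 2 r, ...],
   cleared of denominators. *)
Lemma newton_mxP j :
  newton_mx j *m ((U n)^T *m U n + k%:M)
    = (\prod_(i < j) a i)%:M - (-1) ^+ j *: UDfall n j.
Proof.
rewrite U_comm; elim: j => [|j IHj].
  by rewrite mul0mx big_ord0 expr0 scale1r subrr.
rewrite /= mulmxDl -!scalemxAl IHj big_ord_recr /=.
set V := UDfall n j; set E := UDmx n.
(* The recursion closes because [E + r + k = a j + (E - r j)]. *)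
rewrite mulmxBr !mulmxDr !mul_mx_scalar exprS mulN1r scaleNr opprK.
rewrite scalerBr scalar_mxM mul_scalar_mx.
move: (V *m E) => W; apply/matrixP=> x y; rewrite !mxE /a.
set P := \prod_(i < j) _; set s := (-1) ^+ j.
case: (x == y); rewrite ?mulr1n ?mulr0n PoszM -[j.+1]addn1 PoszD; ring.
Qed.

Lemma newton_mx_eq0 j x y : (forall i, (i < j)%N -> UDfall n i x y = 0) ->
  newton_mx j x y = 0.
Proof.
elim: j => [|j IHj] V0; first by rewrite mxE.
rewrite /= !mxE IHj ?V0 ?mulr0 ?addr0 // => i ij.
by rewrite V0 // ltnW.
Qed.

End Newton.

(** * Chains of thin elements *)

(* [x] covers [x'] and nothing else, and [x'] covers at most one element. *)
Definition thin m (x : 'I_(p m.+1)) (x' : 'I_(p m)) : Prop :=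
  (forall z, U m x z = (z == x')%:R) /\ UDmx m x' x' <= 1.

(** Rows [x] and [y] of [U m] are unit vectors. With [UDfallS], this moves entries of [UDfall] down
    the two chains. *)
Lemma conj_thin m (x y : 'I_(p m.+1)) x' y' : thin m x x' -> thin m y y' ->
  forall M : 'M[int]_(p m), (U m *m M *m (U m)^T) x y = M x' y'.
Proof.
move=> [Ux _] [Uy _] M; rewrite mxE (bigD1 y') //= big1 => [|z zy'].
  rewrite !mxE Uy eqxx mulr1 addr0 (bigD1 x') //= Ux eqxx mul1r.
  by rewrite big1 ?addr0 // => z /negbTE zx'; rewrite Ux zx' mul0r.
by rewrite [(U m)^T _ _]mxE Uy (negbTE zy') mulr0.
Qed.

Lemma UDmx_thin1 m (x : 'I_(p m.+1)) x' : thin m x x' -> UDmx m.+1 x x = 1.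
Proof.
move=> tx; have := conj_thin _ _ _ _ _ tx tx 1%:M.
by rewrite mulmx1 [UDmx _]/= => ->; rewrite mxE eqxx.
Qed.

(* Counting pairs [(y, z)] with [y] covering both [x] and [z]: there are at
   most [2 r + 1] of them, while [x] has [r + 1] upper covers, so some [y] covers
   [x] only. *)
Lemma thin_cover m (x : 'I_(p m.+1)) x' : thin m x x' -> exists y, thin m.+1 y x.
Proof.
move=> tx; have [Ux UDx'] := tx.
have U_ge0 l (u : 'I_(p l.+1)) v : 0 <= U l u v.
  by case: (U01 l u v) => ->.
have U_idem l (u : 'I_(p l.+1)) v : U l u v * U l u v = U l u v.
  by case: (U01 l u v) => ->.
suff [y Uyx sumy] : exists2 y, U m.+1 y x = 1 & \sum_z U m.+1 y z <= 1.
  exists y; split; last by rewrite (UDmx_thin1 _ _ _ tx).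
  move=> z; case: eqVneq => [-> //|zx].
  have sum0 : \sum_(z | z != x) U m.+1 y z = 0.
    apply/eqP; rewrite eq_le sumr_ge0 // andbT.
    by rewrite -(lerD2l 1) addr0; move: sumy; rewrite (bigD1 x) //= Uyx.
  by have /psumr_eq0P -> := sum0.
case: (boolP [exists y, (U m.+1 y x == 1) && (\sum_z U m.+1 y z <= 1)]).
  by case/existsP=> y /andP[/eqP ? ?]; exists y.
move/existsPn => noy; exfalso.
have DUx z : ((U m.+1)^T *m U m.+1) x z = U m z x' + (r%:Z *+ (x == z)).
  rewrite U_comm !mxE (bigD1 x') //= big1 => [|w /negbTE wx'].
    by rewrite Ux eqxx mul1r mxE addr0.
  by rewrite Ux wx' mul0r.
have up : \sum_y U m.+1 y x = 1 + r%:Z.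
  have := DUx x; rewrite Ux !eqxx mxE /= mulr1n => <-.
  by apply: eq_bigr => y _; rewrite mxE U_idem.
have sib : \sum_z U m z x' <= 1 + r%:Z.
  rewrite (eq_bigr (fun z => (U m)^T x' z * U m z x')); last first.
    by move=> z _; rewrite mxE U_idem.
  have := congr1 (fun M : 'M_(p m) => M x' x') (U_comm m).
  by rewrite mxE => ->; rewrite !mxE eqxx mulr1n lerD2r.
(* Failing such a [y], each of the [r + 1] upper covers of [x] covers at least two elements; summing
   over [z] first bounds the same count by [2 r + 1]. *)
have : \sum_y U m.+1 y x * 2 <= \sum_y U m.+1 y x * \sum_z U m.+1 y z.
  apply: ler_sum => y _; have := noy y.
  case: (U01 m.+1 y x) => ->; rewrite ?mul0r // eqxx /= !mul1r; lia.
rewrite -mulr_suml up.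
have -> : \sum_y U m.+1 y x * \sum_z U m.+1 y z
       = \sum_z (U m z x' + (r%:Z *+ (x == z))).
  under eq_bigr do rewrite mulr_sumr.
  rewrite exchange_big; apply: eq_bigr => z _ /=; rewrite -DUx mxE.
  by apply: eq_bigr => y _; rewrite mxE.
rewrite big_split /= (bigD1 (F := fun z => r%:Z *+ (x == z)) x) //= eqxx.
rewrite [X in _ + (_ + X)]big1 => [|z /negbTE]; last by rewrite eq_sym => ->.
by rewrite mulr1n addr0; move: (\sum_(z < _) U m z x') sib => S; lia.
Qed.

(* Two elements of rank [m.+1] that are the tops of chains of thin elements which
   first meet [i.+1] steps below. *)
Definition thin_pair (m i : nat) : Prop :=
  exists x y x' y', [/\ x != y, thin m x x', thin m y y',
    forall j, (j <= i)%N -> UDfall m.+1 j x y = 0 & UDfall m.+1 i.+1 x y = 1].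

(** Both chains grow by [thin_cover]; the new tops differ since their unique lower covers do. *)
Lemma thin_pairS m i : thin_pair m i -> thin_pair m.+1 i.+1.
Proof.
case=> x [y [x' [y' [xy tx ty V0 V1]]]].
have [u tu] := thin_cover _ _ _ tx; have [v tv] := thin_cover _ _ _ ty.
exists u, v, x, y; split=> //.
- apply: contra_neq xy => uv; have := tu.1 x; rewrite uv tv.1 eqxx.
  by case: eqP.
- case=> [|j] ji; last by rewrite UDfallS (conj_thin _ _ _ _ _ tu tv) V0.
  rewrite mxE; case: eqP => // uv; move: xy.
  by have := tu.1 x; rewrite uv tv.1 eqxx; case: eqP => // ->; rewrite eqxx.
- by rewrite UDfallS (conj_thin _ _ _ _ _ tu tv) V1.
Qed.

Lemma thin_pair0 m (x y : 'I_(p m.+1)) x' :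
  x != y -> thin m x x' -> thin m y x' -> thin_pair m 0.
Proof.
move=> xy tx ty; exists x, y, x', x'; split=> //.
- by move=> j; rewrite leqn0 => /eqP ->; rewrite mxE (negbTE xy).
- by rewrite UDfallS (conj_thin _ _ _ _ _ tx ty) mxE eqxx.
Qed.

Lemma two_covers m (x : 'I_(p m)) : 1 < ((U m)^T *m U m) x x ->
  exists y z, [/\ y != z, U m y x = 1 & U m z x = 1].
Proof.
rewrite mxE => gt1.
case: (pickP (fun y => U m y x == 1)) => [y /eqP Uy|U0]; last first.
  move: gt1; rewrite big1 // => y _; rewrite mxE.
  by case: (U01 m y x) (U0 y) => -> //; rewrite eqxx.
case: (pickP (fun z => (z != y) && (U m z x == 1))) => [z /andP[zy /eqP Uz]|U0].
  by exists z, y.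
move: gt1; rewrite (bigD1 y) //= mxE Uy big1 // => z zy; rewrite mxE.
by case: (U01 m z x) (U0 z) => -> //; rewrite zy eqxx.
Qed.

Lemma rank0_eq (x y : 'I_(p 0)) : x = y.
Proof. exact: ord_eq_size1. Qed.

Lemma U0_eq1 x z : U 0 x z = 1.
Proof.
have [j] := U_row_neq0 0 x; rewrite (rank0_eq z j).
by case: (U01 0 x j) => -> //; rewrite eqxx.
Qed.

Lemma thin_rank1 (x : 'I_(p 1)) (z : 'I_(p 0)) : thin 0 x z.
Proof.
split; last by rewrite mxE.
by move=> w; rewrite U0_eq1 (rank0_eq w z) eqxx.
Qed.

Lemma thin_pair_diag m : (1 < r)%N -> thin_pair m m.
Proof.
move=> r_gt1; elim: m => [|m]; last exact: thin_pairS.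
have z : 'I_(p 0) by rewrite p0; exact: ord0.
have [|x [y [xy _ _]]] := two_covers 0 z.
  by rewrite U_comm !mxE eqxx add0r mulr1n; lia.
by apply: thin_pair0 xy (thin_rank1 x z) (thin_rank1 y z).
Qed.

(** * The case [r = 1] *)

Section OneDifferential.

Hypothesis r1 : r = 1%N.

Lemma rank1_eq (x y : 'I_(p 1)) : x = y.
Proof.
have z : 'I_(p 0) by rewrite p0; exact: ord0.
have := congr1 (fun M : 'M_(p 0) => M z z) (U_comm 0).
rewrite !mxE eqxx r1 mulr1n add0r; under eq_bigr do rewrite mxE U0_eq1 mulr1.
rewrite sumr_const card_ord => /eqP; rewrite natz => /eqP [p1].
exact: ord_eq_size1.
Qed.

Lemma UDmx_rank1 : UDmx 1 = 1%:M.
Proof.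
apply/matrixP=> x y; rewrite (rank1_eq y x) !mxE eqxx.
have z : 'I_(p 0) by rewrite p0; exact: ord0.
rewrite (bigD1 z) //= mxE !U0_eq1 big1 // => w /negP[].
by rewrite (rank0_eq w z) eqxx.
Qed.

(** Descending to rank 1 reduces this to [UDmx 1] being the identity. *)
Lemma UDfall_rankV m : UDfall m.+1 m.+1 = UDfall m.+1 m.
Proof.
elim: m => [|m IHm]; last by rewrite UDfallS IHm -UDfallS.
by rewrite UDfallS mulmx1; apply: UDmx_rank1.
Qed.

Lemma rank1_inhabited : inhabited 'I_(p 1).
Proof.
have z : 'I_(p 0) by rewrite p0; exact: ord0.
case: (pickP 'I_(p 1)) => [x _ | no]; first exact: (inhabits x).
have := congr1 (fun M : 'M_(p 0) => M z z) (U_comm 0).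
by rewrite !mxE eqxx r1 big1 // => i; have := no i.
Qed.

(** The chains now part at rank 1, whose only element has [1 + r = 2] upper covers. *)
Lemma thin_pair_subdiag m : thin_pair m.+1 m.
Proof.
elim: m => [|m]; last exact: thin_pairS.
have z : 'I_(p 0) by rewrite p0; exact: ord0.
have [j] := rank1_inhabited.
have thin1 (y : 'I_(p 2)) : U 1 y j = 1 -> thin 1 y j.
  move=> Uy; split; last by rewrite UDmx_rank1 mxE eqxx.
  by move=> w; rewrite (rank1_eq w j) eqxx.
have [|x [y [xy Ux Uy]]] := two_covers 1 j.
  by rewrite U_comm UDmx_rank1 !mxE eqxx r1.
by apply: thin_pair0 xy (thin1 x Ux) (thin1 y Uy).
Qed.

End OneDifferential.

(** * Multipliers with a unit entry *)

Lemma UDfall_unit_entry n (c := if (1 < r)%N then n else n.-1) : (0 < r)%N ->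
  exists x y : 'I_(p n),
    (forall j, (j < c)%N -> UDfall n j x y = 0) /\ UDfall n c x y = 1.
Proof.
rewrite {}/c => r_gt0; case: ltnP => [r_gt1 | r_le1].
  case: n => [|n].
    have z : 'I_(p 0) by rewrite p0; exact: ord0.
    by exists z, z; rewrite mxE eqxx.
  by have [x [y [_ [_ [_ _ _ V0 V1]]]]] := thin_pair_diag n r_gt1; exists x, y.
have r1 : r = 1%N by lia.
(* In ranks 0 and 1 the index [c] is 0, and a diagonal entry of the identity serves. *)
case: n => [|[|n]] /=.
- have z : 'I_(p 0) by rewrite p0; exact: ord0.
  by exists z, z; rewrite mxE eqxx.
- have [x] := rank1_inhabited r1.
  by exists x, x; rewrite mxE eqxx.
- by have [x [y [_ [_ [_ _ _ V0 V1]]]]] := thin_pair_subdiag r1 n; exists x, y.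
Qed.

Lemma unit_entry_multiplier n (k : int) : (0 < r)%N ->
  exists Q : 'M[int]_(p n), exists x y : 'I_(p n), `|Q x y| = 1 /\
    Q *m ((U n)^T *m U n + k%:M)
      = (if (2 <= r)%N then fact_rk r%:Z k (n%:Z + 1)
         else fact_rk 1 k (n%:Z - 1) * (n%:Z + 1 + k))%:M.
Proof.
move=> r_gt0; have [x [y []]] := UDfall_unit_entry n r_gt0.
set c := if _ then _ else _ => V0 V1.
(* At [(x, y)] the Newton part vanishes, leaving [(-1) ^+ c]. *)
suff [b Qb] : exists b, (b *: newton_mx n k c + (-1) ^+ c *: UDfall n c)
    *m ((U n)^T *m U n + k%:M)
      = (if (2 <= r)%N then fact_rk r%:Z k (n%:Z + 1)
         else fact_rk 1 k (n%:Z - 1) * (n%:Z + 1 + k))%:M.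
  eexists; exists x, y; split; last exact: Qb.
  by rewrite !mxE newton_mx_eq0 // V1 mulr0 add0r mulr1 normrX normrN1 expr1n.
rewrite {V0 V1}/c; case: ltnP => [r_gt1 | r_le1].
  exists (r%:Z * n.+1%:Z + k); have := newton_mxP n k n.+1.
  rewrite UDfall_rank scaler0 subr0 /= => ->.
  by rewrite -fact_rkE -PoszD addn1.
have r1 : r = 1%N by lia.
case: n {x y} => [|n].
  (* Here the factorial has argument [-1] and equals 1. *)
  exists (r%:Z * 1%:Z + k); have := newton_mxP 0 k 1.
  rewrite UDfall_rank scaler0 subr0 /= => ->.
  by rewrite big_ord1 r1 !mul1r.
(* By [UDfall_rankV], [UDmx n.+1] acts on [UDfall n.+1 n] as the scalar [n + 1]; this choice of [b]
   cancels the Newton error term. *)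
exists (n.+1%:Z + 1 + k); rewrite mulmxDl -!scalemxAl newton_mxP /=.
have -> : UDfall n.+1 n *m ((U n.+1)^T *m U n.+1 + k%:M)
   = (n.+1%:Z + 1 + k) *: UDfall n.+1 n.
  have := UDfall_rankV r1 n; rewrite /= mulmxBr mul_mx_scalar r1 mul1n.
  move/eqP; rewrite subr_eq => /eqP EV; rewrite U_comm !mulmxDr EV.
  rewrite !mul_mx_scalar r1 -!addrA -!scalerDl -[X in X + _]scale1r -scalerDl.
  by congr (_ *: _); lia.
rewrite scalerBr !scalerA [(-1) ^+ n * _]mulrC subrK.
rewrite scale_scalar_mx mulrC r1 -fact_rkE.
by congr (fact_rk _ _ _ * _)%:M; lia.
Qed.

End DifferentialMatrices.

(** * From characters to matrices *)

Section TowerMatrices.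

Variable T : group_tower.
Local Notation G := (tw_G T).

(** Frobenius reciprocity, transported along the isometry from [G m] to its image. *)
Lemma cfdot_twRes m (psi : 'CF(G m.+1)) (chi : 'CF(G m)) :
  '[twRes psi, chi] = '[psi, twInd chi].
Proof.
rewrite /twInd -cfdot_Res_l -(cfIsom_iso (tw_isom T m)); congr '[_, _].
apply/cfun_inP=> _ /morphimP[x Gx _ ->].
by rewrite cfIsomE // cfMorphE.
Qed.

Lemma twRes1 m (psi : 'CF(G m.+1)) : twRes psi 1%g = psi 1%g.
Proof. by rewrite cfMorph1 cfRes1. Qed.

Lemma Nirr_tw0 : Nirr (G 0) = 1%N.
Proof.
have /eqP G0 := tw_G0 T; rewrite NirrE.
have : abelian (G 0) by move: G0; rewrite -trivg_card1 => /eqP ->; apply: abelian1.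
by rewrite card_classes_abelian => /eqP ->; apply/eqP.
Qed.

Lemma upmx01 m i j : upmx T m i j = 0 \/ upmx T m i j = 1.
Proof. by rewrite mxE; case: (_ \in _); [right | left]. Qed.

(** Restriction preserves the positive degree, so it is nonzero and has a constituent. *)
Lemma upmx_row_neq0 m i : exists j, upmx T m i j != 0.
Proof.
have [|j Rj] := @neq0_has_constt _ _ (twRes 'chi[G m.+1]_i).
  apply: contraTneq (irr1_gt0 i) => R0; have := twRes1 m 'chi_i.
  by rewrite R0 cfunE => <-; rewrite ltxx.
by exists j; rewrite mxE Rj.
Qed.

Variable r : nat.
Hypothesis hT : r_differential_tower T r.

(** Since restriction is multiplicity-free, being a constituent and the multiplicity carry the same
    value. *)
Lemma upmxE m i j : (upmx T m i j)%:~R = '[twRes 'chi_i, 'chi_j] :> algC.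
Proof.
by rewrite mxE irr_consttE; case: (hT.1 m i j) => ->; rewrite ?eqxx ?oner_eq0.
Qed.

Lemma cfdot_twIndE m i j :
  '[twInd 'chi[G m]_j, 'chi_i] = (upmx T m i j)%:~R.
Proof. by rewrite cfdotC -cfdot_twRes -upmxE rmorph_int. Qed.

Lemma cfdot_twRes_twInd m i j :
  '[twRes (twInd 'chi[G m]_j), 'chi_i] = (((upmx T m)^T *m upmx T m) i j)%:~R.
Proof.
rewrite cfdot_twRes cfdot_sum_irr mxE rmorph_sum; apply: eq_bigr => l _.
by rewrite !cfdot_twIndE rmorph_int rmorphM mulrC [_^T _ _]mxE.
Qed.

Lemma cfdot_twIndRes m i j :
  '[twIndRes 'chi[G m]_j, 'chi_i] = (UDmx _ (upmx T) m i j)%:~R.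
Proof.
case: m i j => [|m] i j; first by rewrite cfdot0l mxE.
rewrite cfdotC -cfdot_twRes cfdot_sum_irr mxE !rmorph_sum.
apply: eq_bigr => l _.
by rewrite -!upmxE [_^T _ _]mxE !rmorphM /= !rmorph_int.
Qed.

Lemma upmx_comm m :
  (upmx T m)^T *m upmx T m = UDmx _ (upmx T) m + (r%:Z)%:M.
Proof.
apply/matrixP=> i j; apply: (@intr_inj algC).
have /(congr1 (fun phi => '[phi, 'chi_i])) := hT.2 m _ (irr_vchar j).
rewrite cfdotBl cfdotZl cfdot_twRes_twInd cfdot_twIndRes cfdot_irr => /eqP.
rewrite subr_eq addrC => /eqP ->; rewrite [in RHS]mxE rmorphD /=.
by congr (_ + _); rewrite mxE eq_sym; case: eqP; rewrite ?mulr1 ?mulr0.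
Qed.

End TowerMatrices.

Theorem theorem6p12 (T : group_tower) (r : nat) (n : nat) (k : int)
  (r_pos : (0 < r)%N) (hT : r_differential_tower T r)
  (d : seq int)
  (hd : smith_diag (DUmx T n + k%:M) d) :
  let A := DUmx T n + k%:M in
  let s := d`_(Nirr (tw_G T n)).-1 in
  (\det A = 0 -> s = 0) /\
  (\det A != 0 ->
     `|s| = `|if (2 <= r)%N then fact_rk r%:Z k (n%:Z + 1)
              else fact_rk 1 k (n%:Z - 1) * (n%:Z + 1 + k)|).
Proof.
split=> [|_]; first exact: smith_diag_singular hd.
have [Q [x [y [Qxy QA]]]] := unit_entry_multiplier _ (upmx T) r (Nirr_tw0 T)
  (upmx01 T) (upmx_row_neq0 T) (upmx_comm T r hT) n k r_pos.
exact: smith_diag_last hd QA Qxy.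
Qed.
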